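(* Let $d\ge2$ and suppose $\mathbf Y$ has a $d$-variate Hüsler--Reiss distribution with variogram matrix $\Gamma\in\mathcal C^d$, Hüsler--Reiss precision matrix $\Theta$, and let $\Theta^{(k)}=(\Sigma^{(k)})^{-1}$ for $k\in[d]$. Then $\mathbf Y$ is $\mathrm{EMTP}_2$ if and only if $\Theta$ is the Laplacian matrix of a connected graph with positive edge weights. Other equivalent conditions are: (i) $\Theta_{ij}\le 0$ for all $i\ne j$. (ii) For all $k=1,\dots,d$, $\Theta^{(k)}$ is a diagonally dominant M-matrix. (iii) For all $k=1,\dots,d$, $\Theta^{(k)}$ is an M-matrix. (iv) For some $k\in[d]$, $\Theta^{(k)}$ is a diagonally dominant M-matrix.
   Context: $[d]=\{1,\dots,d\}$; $\boldsymbol 1$ is the vector of ones; $\vee,\wedge$ are componentwise maximum and minimum. Multivariate Pareto distribution: a random vector $\mathbf Y$ supported on $\mathcal L=\{\mathbf x\in\mathbb R^d:\max_i x_i>0\}$ such that $\mathbb P(\mathbf Y\le \mathbf z)=\lim_{u\to\infty}\mathbb P(\mathbf X-u\boldsymbol 1\le\mathbf z\mid \max_i X_i>u)$ for $\mathbf z\in\mathcal L$, for some random vector $\mathbf X$ with standard exponential margins. It satisfies $\mathbb P(\mathbf Y\in t\boldsymbol 1+A)=e^{-t}\mathbb P(\mathbf Y\in A)$ for $t>0$, Borel $A\subset\mathcal L$. For $k\in[d]$, $\mathbf Y^k$ is $\mathbf Y$ conditioned on $\{Y_k>0\}$; one has $\mathbf Y^k\overset{d}{=}\mathbf W^k+E\boldsymbol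 1$ with $E$ standard exponential independent of $\mathbf W^k$, $W^k_k=0$ a.s. A random vector with density $f$ is $\mathrm{MTP}_2$ if $f(\mathbf x\vee\mathbf y)f(\mathbf x\wedge\mathbf y)\ge f(\mathbf x)f(\mathbf y)$ for all $\mathbf x,\mathbf y$; $\mathbf Y$ is $\mathrm{EMTP}_2$ if $\mathbf Y^k$ is $\mathrm{MTP}_2$ for all $k\in[d]$. $\mathcal C^d$ is the set of symmetric $d\times d$ matrices $\Gamma$ with zero diagonal that are strictly conditionally negative definite: $\boldsymbol x^T\Gamma\boldsymbol x<0$ for all $\boldsymbol x\ne\boldsymbol 0$ with $\boldsymbol x^T\boldsymbol 1=0$. The Hüsler--Reiss distribution with parameter $\Gamma\in\mathcal C^d$ is the multivariate Pareto distribution for which, for each $k$, $\mathbf W^k_{\setminus k}=(W^k_i)_{i\neq k}$ is $(d-1)$-variate normal with mean $-\mathrm{diag}(\Sigma^{(k)})/2$ and covariance $\Sigma^{(k)}$, where $\Sigma^{(k)}_{ij}=\frac12(\Gamma_{ik}+\Gamma_{jk}-\Gamma_{ij})$, $i,j\ne k$ (a positive definite matrix). The Hüsler--Reiss precision matrix is $\Theta=\big(\boldsymbol P(-\tfrac12\Gamma)\boldsymbol P\big)^+$ (Moore--Penrose inverse), $\boldsymbol P=I_d-\frac1d\boldsymbol 1\boldsymbol 1^T$; equivalently, $\Theta_{ij}=\Theta^{(k)}_{ij}$ for $i,j\neq k$ and $\Theta\boldsymbol 1=\boldsymbol 0$. An M-matrix is a symmetric positive definite matrix with nonpositive off-diagonal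 entries; it is diagonally dominant if all row sums are nonnegative. A Laplacian matrix of a connected graph with positive edge weights is a symmetric matrix with zero row sums and nonpositive off-diagonal entries such that the graph with edges $\{ij:i\neq j,\Theta_{ij}\ne0\}$ is connected. *)

(* Defs.v *)
From HB Require Import structures.
From mathcomp Require Import all_boot all_order all_algebra.
From mathcomp Require Import all_classical all_reals all_analysis.

Set Implicit Arguments.
Unset Strict Implicit.
Unset Printing Implicit Defensive.

Import Order.TTheory GRing.Theory Num.Theory.
Import numFieldNormedType.Exports.

Local Open Scope classical_set_scope.
Local Open Scope ring_scope.

(* Points of R^n are elements of [n.-tuple R], which the library equips with
   the product sigma-algebra. *)

(* Lebesgue measure on R^n, as the n-fold product of [lebesgue_measure]. *)
Section lebesgue_tuple.
Context {R : realType}.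

Definition cons_pair n (p : R * n.-tuple R) : n.+1.-tuple R :=
  [tuple of p.1 :: p.2].

Lemma measurable_cons_pair n : measurable_fun [set: _] (@cons_pair n).
Proof. exact: measurable_cons. Qed.

Section cons_measure.
Variables (n : nat) (mu : {sigma_finite_measure set (n.-tuple R) -> \bar R}).

Definition cons_measure : set (n.+1.-tuple R) -> \bar R :=
  pushforward (@lebesgue_measure R \x mu)%E (@cons_pair n).

Let cons_measure0 : cons_measure set0 = 0%E.
Proof. by rewrite /cons_measure /pushforward preimage_set0 measure0. Qed.

Let cons_measure_ge0 A : (0 <= cons_measure A)%E.
Proof. by rewrite /cons_measure /pushforward measure_ge0. Qed.

Let cons_measure_sigma_additive : semi_sigma_additive cons_measure.
Proof.
move=> F mF tF mUF; rewrite /cons_measure /pushforward preimage_bigcup.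
apply: measure_semi_sigma_additive.
- by move=> i; rewrite -[X in measurable X]setTI; exact: measurable_cons_pair.
- apply/trivIsetP => /= i j _ _ ij; rewrite -preimage_setI.
  by move/trivIsetP : tF => /(_ _ _ _ _ ij) ->//; rewrite preimage_set0.
- rewrite -preimage_bigcup -[X in measurable X]setTI.
  exact: measurable_cons_pair.
Qed.

HB.instance Definition _ := isMeasure.Build _ _ _ cons_measure
  cons_measure0 cons_measure_ge0 cons_measure_sigma_additive.

Let cons_measure_sigma_finite : sigma_finite setT cons_measure.
Proof.
have /sigma_finiteP[F [FT ndF Foo]] := sigma_finiteT (@lebesgue_measure R).
have /sigma_finiteP[G [GT ndG Goo]] := sigma_finiteT mu.
pose g (t : n.+1.-tuple R) : R * n.-tuple R := (thead t, [tuple of behead t]).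
have mg : measurable_fun setT g.
  apply/measurable_fun_pairP; split; first exact: (measurable_tnth ord0).
  exact: measurable_behead.
have cons_pairK p : g (cons_pair p) = p.
  by case: p => x t; congr (_, _); apply/val_inj.
have gK A : @cons_pair n @^-1` (g @^-1` A) = A.
  by apply/seteqP; split=> p; rewrite /preimage/= cons_pairK.
exists (fun i => g @^-1` (F i `*` G i)) => [|i].
  rewrite -preimage_bigcup (_ : \bigcup_i _ = setT) ?preimage_setT//.
  apply/seteqP; split=> // -[x t] _.
  have [i _ Fx] : (\bigcup_i F i) x by rewrite -FT.
  have [j _ Gt] : (\bigcup_i G i) t by rewrite -GT.
  exists (maxn i j) => //; split => /=.
    by move: x Fx; exact/subsetPset/ndF/leq_maxl.
  by move: t Gt; exact/subsetPset/ndG/leq_maxr.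
have [mFi Fioo] := Foo i; have [mGi Gioo] := Goo i; split.
  by rewrite -[X in measurable X]setTI; apply: mg => //; exact: measurableX.
rewrite /cons_measure /pushforward gK product_measure1E//.
by rewrite lte_mul_pinfty// ge0_fin_numE.
Qed.

HB.instance Definition _ := Measure_isSigmaFinite.Build _ _ _ cons_measure
  cons_measure_sigma_finite.

End cons_measure.

Fixpoint lebesgue_tuple n : {sigma_finite_measure set (n.-tuple R) -> \bar R} :=
  match n with
  | 0 => \d_[tuple]
  | n'.+1 => cons_measure (lebesgue_tuple n')
  end.

Lemma lebesgue_tuple_box n (A : 'I_n -> set R) :
  (forall i, measurable (A i)) ->
  lebesgue_tuple n [set t | forall i, A i (tnth t i)] =
  (\prod_(i < n) lebesgue_measure (A i))%E.
Proof.
elim: n A => [|n IHn] A mA.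
  rewrite big_ord0/= (_ : [set _ | _] = setT) ?diracT//.
  by apply/seteqP; split=> // t _ [].
rewrite big_ord_recl /= /cons_measure /pushforward.
pose B := [set t : n.-tuple R | forall i, A (lift ord0 i) (tnth t i)].
have mB : measurable B.
  rewrite (_ : B = \bigcap_(i in [set: 'I_n])
      (setT `&` (@tnth n R ^~ i) @^-1` A (lift ord0 i))).
    apply: fin_bigcap_measurable => // i _.
    exact: measurable_tnth.
  apply/seteqP; split=> t /= tB i; first by split=> //; exact: tB.
  by have [] := tB i I.
rewrite (_ : _ @^-1` _ = A ord0 `*` B).
  rewrite product_measure1E; [|exact: mA|exact: mB]; congr (_ * _)%E.
  exact: IHn.
apply/seteqP; split=> -[x t] /=.
  move=> xt; split=> [|i]; first exact: (xt ord0).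
  by have := xt (lift ord0 i); rewrite /cons_pair tnthS.
move=> [/= xA tB] i; case: (unliftP ord0 i) => [j|] ->; last exact: xA.
by rewrite /cons_pair tnthS; exact: tB.
Qed.

End lebesgue_tuple.

Section random_vectors.
Context {R : realType}.

Definition vec n (t : n.-tuple R) : 'cV[R]_n := \col_i tnth t i.

Definition vmax n (x y : n.-tuple R) : n.-tuple R :=
  [tuple Num.max (tnth x i) (tnth y i) | i < n].

Definition vmin n (x y : n.-tuple R) : n.-tuple R :=
  [tuple Num.min (tnth x i) (tnth y i) | i < n].

(* x + a 1 *)
Definition shift n (x : n.-tuple R) (a : R) : n.-tuple R :=
  [tuple tnth x i + a | i < n].

(* x with its k-th coordinate removed *)
Definition remove n (k : 'I_n) (x : n.-tuple R) : n.-1.-tuple R :=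
  [tuple tnth x (lift k i) | i < n.-1].

Definition vle n (x z : n.-tuple R) : Prop := forall i, tnth x i <= tnth z i.

(* [set x | max_i x_i > u] *)
Definition max_gt n (u : R) : set (n.-tuple R) :=
  [set x | exists i, u < tnth x i].

Definition has_density n (mu : set (n.-tuple R) -> \bar R)
    (f : n.-tuple R -> R) : Prop :=
  [/\ measurable_fun [set: n.-tuple R] f,
      (forall x, 0 <= f x) &
      (forall A, measurable A ->
         mu A = (\int[lebesgue_tuple n]_(x in A) (f x)%:E)%E)].

(* A law determines its density only up to null sets: the inequality is
   required of some version of the density. *)
Definition MTP2 n (mu : set (n.-tuple R) -> \bar R) : Prop :=
  exists f : n.-tuple R -> R, has_density mu f /\
    (forall x y, f x * f y <= f (vmax x y) * f (vmin x y)).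

Definition quad_form n (A : 'M[R]_n) (x : 'cV[R]_n) : R :=
  (x^T *m A *m x) 0 0.

Definition posdef n (A : 'M[R]_n) : Prop :=
  A^T = A /\ (forall x : 'cV[R]_n, x != 0 -> 0 < quad_form A x).

(* density of N(m, S), for S positive definite *)
Definition mvnormal_pdf n (m : 'cV[R]_n) (S : 'M[R]_n) (x : n.-tuple R) : R :=
  (Num.sqrt ((2 * pi) ^+ n * \det S))^-1 *
  expR (- (quad_form (invmx S) (vec x - m) / 2)).

Definition cond_prob d (T : measurableType d) (P : probability T R)
    (A B : set T) : R :=
  fine (P (A `&` B)) / fine (P B).

Definition independent d d1 d2 (T : measurableType d) (P : probability T R)
    (T1 : measurableType d1) (T2 : measurableType d2)
    (X1 : {RV P >-> T1}) (X2 : {RV P >-> T2}) : Prop :=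
  forall A1 A2, measurable A1 -> measurable A2 ->
    P (X1 @^-1` A1 `&` X2 @^-1` A2) = (P (X1 @^-1` A1) * P (X2 @^-1` A2))%E.

Section multivariate_pareto.
Context d (T : measurableType d) (P : probability T R).
Variables (n : nat) (Y : {RV P >-> n.-tuple R}).

Definition multivariate_pareto : Prop :=
  {ae P, forall w, max_gt 0 (Y w)} /\
  exists (d' : measure_display) (T' : measurableType d')
    (Q : probability T' R) (X : {RV Q >-> n.-tuple R}),
    (forall i (A : set R), measurable A ->
       Q [set w | A (tnth (X w) i)] = exponential_prob 1 A) /\
    (forall z, max_gt 0 z ->
       cond_prob Q [set w | vle (shift (X w) (- u)) z] (X @^-1` max_gt u)
         @[u --> +oo] --> fine (P [set w | vle (Y w) z])).

(* the law of Y^k, i.e. of Y conditioned on Y_k > 0 *)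
Definition cond_law (k : 'I_n) (A : set (n.-tuple R)) : \bar R :=
  (cond_prob P (Y @^-1` A) [set w | 0 < tnth (Y w) k])%:E.

Definition EMTP2 : Prop := forall k, MTP2 (cond_law k).

End multivariate_pareto.

Definition variogram_matrix n (Gamma : 'M[R]_n) : Prop :=
  [/\ Gamma^T = Gamma,
      (forall i, Gamma i i = 0) &
      (forall x : 'cV[R]_n, x != 0 -> x^T *m const_mx 1 = (0 : 'M[R]_1) ->
         quad_form Gamma x < 0)].

(* Sigma^(k), with rows and columns indexed by [n] \ {k} via [lift k] *)
Definition hr_Sigma n (Gamma : 'M[R]_n) (k : 'I_n) : 'M[R]_n.-1 :=
  \matrix_(i, j) (2^-1 * (Gamma (lift k i) k + Gamma (lift k j) k
                          - Gamma (lift k i) (lift k j))).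

Definition hr_Theta n (Gamma : 'M[R]_n) (k : 'I_n) : 'M[R]_n.-1 :=
  invmx (hr_Sigma Gamma k).

Definition husler_reiss n (Gamma : 'M[R]_n) d (T : measurableType d)
    (P : probability T R) (Y : {RV P >-> n.-tuple R}) : Prop :=
  multivariate_pareto Y /\
  forall k : 'I_n,
  exists (d' : measure_display) (T' : measurableType d')
    (Q : probability T' R) (W : {RV Q >-> n.-tuple R}) (E : {RV Q >-> R}),
  [/\ (forall A : set R, measurable A -> Q (E @^-1` A) = exponential_prob 1 A),
      independent W E,
      {ae Q, forall w, tnth (W w) k = 0},
      (forall A, measurable A ->
         cond_law Y k A = Q [set w | A (shift (W w) (E w))]) &
      has_density (fun A => Q [set w | A (remove k (W w))])
        (mvnormal_pdf
           (\col_i (- (hr_Sigma Gamma k i i / 2))) (hr_Sigma Gamma k))].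

Definition moore_penrose_inverse m n (A : 'M[R]_(m, n)) (B : 'M[R]_(n, m)) :
    Prop :=
  [/\ A *m B *m A = A, B *m A *m B = B,
      (A *m B)^T = A *m B & (B *m A)^T = B *m A].

Lemma moore_penrose_inverse_uniq m n (A : 'M[R]_(m, n)) (B C : 'M[R]_(n, m)) :
  moore_penrose_inverse A B -> moore_penrose_inverse A C -> B = C.
Proof.
move=> [ABA BAB sAB sBA] [ACA CAC sAC sCA].
have AB_AC : A *m B = A *m C.
  by rewrite -sAB -{1}ACA -mulmxA trmx_mul sAB sAC mulmxA ABA.
have BA_CA : B *m A = C *m A.
  have : (B *m A) *m (C *m A) = B *m A by rewrite mulmxA -(mulmxA B) -mulmxA ACA.
  move/(congr1 trmx); rewrite trmx_mul sBA sCA => <-.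
  by rewrite mulmxA -(mulmxA C) -mulmxA ABA.
by rewrite -BAB BA_CA -mulmxA AB_AC mulmxA CAC.
Qed.

(* P = I - (1/n) 1 1^T *)
Definition centering_mx n : 'M[R]_n := 1%:M - n%:R^-1 *: const_mx 1.

Definition hr_precision n (Gamma Theta : 'M[R]_n) : Prop :=
  moore_penrose_inverse
    (centering_mx n *m ((- 2^-1) *: Gamma) *m centering_mx n) Theta.

Definition M_matrix n (A : 'M[R]_n) : Prop :=
  posdef A /\ (forall i j, i != j -> A i j <= 0).

Definition dd_M_matrix n (A : 'M[R]_n) : Prop :=
  M_matrix A /\ (forall i, 0 <= \sum_j A i j).

(* [fingraph.connect e] is the reflexive transitive closure of e. *)
Definition connected_laplacian n (A : 'M[R]_n) : Prop :=
  [/\ A^T = A,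
      (forall i, \sum_j A i j = 0),
      (forall i j, i != j -> A i j <= 0) &
      (forall i j, fingraph.connect
         [rel i j : 'I_n | (i != j) && (A i j != 0)] i j)].

End random_vectors.

(* Main.v *)
(** In coordinates centred at a base index k, the law of Y^k has the density
    f_k(y) = K exp(- y^T Theta y / 2 + b y) on {y_k >= 0} and 0 elsewhere: the
    shear and relabelling (e, w) |-> (w_j + e; e) preserve Lebesgue measure, and
    y |-> (y_j - y_k)_(j <> k) turns the quadratic form of Theta^(k) into that of
    Theta.  The mixed second difference of log f_k in directions e_i, e_j is the
    constant - Theta_ij, so the MTP2 inequality, which another version of the
    density satisfies, has to be tested at a single point p outside a null set;
    conversely Theta_ij <= 0 gives it coordinate by coordinate.  The remaining
    equivalences are linear algebra: Theta^(k) is the minor of Theta obtained by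
    deleting k, the rows of Theta sum to zero, and the kernel of Theta is spanned
    by the vector of ones, which forces connectedness. *)
From HB Require Import structures.
Require Import Defs.
From mathcomp Require Import all_boot all_order all_algebra.
From mathcomp Require Import all_classical all_reals all_analysis.
From mathcomp Require Import measurable_realfun ring lra.
Import Order.TTheory GRing.Theory Num.Theory.
Local Open Scope ring_scope.

Set Implicit Arguments.
Unset Strict Implicit.
Unset Printing Implicit Defensive.
Local Open Scope classical_set_scope.
Local Open Scope ring_scope.

(** * Linear algebra of the Huesler-Reiss precision matrix *)

Section linear_algebra.
Context {R : realType}.

Lemma quad_formE n (A : 'M[R]_n) (x : 'cV[R]_n) :
  quad_form A x = \sum_i \sum_j A i j * (x i 0 * x j 0).
Proof.
rewrite /quad_form mxE exchange_big /=; apply: eq_bigr => j _.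
rewrite mxE big_distrl /=; apply: eq_bigr => i _; rewrite mxE; ring.
Qed.

Lemma quad_form_mulmx m n (A : 'M[R]_n) (B : 'M[R]_(n, m)) (x : 'cV[R]_m) :
  quad_form A (B *m x) = quad_form (B^T *m A *m B) x.
Proof. by rewrite /quad_form trmx_mul !mulmxA. Qed.

Lemma quad_form_scale n a (A : 'M[R]_n) x :
  quad_form (a *: A) x = a * quad_form A x.
Proof. by rewrite /quad_form -scalemxAr -scalemxAl mxE. Qed.

Lemma sum_row_mulmx m n (A : 'M[R]_(m, n)) i :
  (A *m (const_mx 1 : 'cV[R]_n)) i 0 = \sum_j A i j.
Proof. by rewrite mxE; apply: eq_bigr => j _; rewrite !mxE mulr1. Qed.

Section centering.
Variable n : nat.
Hypothesis n_gt0 : (0 < n)%N.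

Lemma centering_tr : (@centering_mx R n)^T = centering_mx n.
Proof. by rewrite /centering_mx linearB /= linearZ /= trmx1 trmx_const. Qed.

Lemma centering_mul1 : centering_mx n *m (const_mx 1 : 'cV[R]_n) = 0.
Proof.
apply/colP => i; rewrite sum_row_mulmx mxE.
under eq_bigr do rewrite !mxE mulr1.
rewrite sumrB sumr_const card_ord (bigD1 i) //= eqxx big1 => [|j /negPf]; last first.
  by rewrite eq_sym => ->.
rewrite addr0 -[X in _ - X]mulr_natr. by rewrite mulVf ?subrr // pnatr_eq0 -lt0n.
Qed.

Lemma centeringE m (B : 'M[R]_(n, m)) :
  (const_mx 1 : 'rV[R]_n) *m B = 0 -> centering_mx n *m B = B.
Proof.
move=> h; rewrite /centering_mx mulmxBl mul1mx -scalemxAl.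
suff -> : (const_mx 1 : 'M[R]_n) *m B = 0 by rewrite scaler0 subr0.
apply/matrixP => i j; have /matrixP /(_ 0 j) := h.
by rewrite !mxE; apply: etrans; apply: eq_bigr => l _; rewrite !mxE.
Qed.

(** Centering subtracts the mean from every coordinate, so a vector it kills has all coordinates
    equal to their mean. *)
Lemma centering_eq0 (x : 'cV[R]_n) :
  centering_mx n *m x = 0 -> forall i j, x i 0 = x j 0.
Proof.
move=> h.
suff E i : x i 0 = n%:R^-1 * \sum_j x j 0 by move=> i j; rewrite !E.
have /colP /(_ i) := h.
rewrite /centering_mx mulmxBl mul1mx -scalemxAl !mxE => /subr0_eq ->.
by congr (_ * _); apply: eq_bigr => j _; rewrite mxE mul1r.
Qed.

End centering.

(* The matrix of x |-> remove k x - x_k 1. *)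
Definition diff_mx n (k : 'I_n) : 'M[R]_(n.-1, n) :=
  \matrix_(i, j) ((j == lift k i)%:R - (j == k)%:R).

(** Padding by a zero at index [k]. On the right it deletes column [k], its transpose on the left
    deletes row [k], and it is a right inverse of [diff_mx k]. *)
Definition lift_mx n (k : 'I_n) : 'M[R]_(n, n.-1) :=
  \matrix_(i, j) (i == lift k j)%:R.

Lemma mulmx_diff m n (k : 'I_n) (B : 'M[R]_(n, m)) i j :
  (diff_mx k *m B) i j = B (lift k i) j - B k j.
Proof.
rewrite mxE; under eq_bigr do rewrite mxE mulrBl.
by rewrite sumrB (bigD1 (lift k i)) //= eqxx mul1r big1 => [|l /negPf->];
   rewrite ?mul0r // addr0 (bigD1 k) //= eqxx mul1r big1 => [|l /negPf->];
   rewrite ?mul0r // addr0.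
Qed.

Lemma mulmx_liftl m n (k : 'I_n) (B : 'M[R]_(n, m)) i j :
  ((lift_mx k)^T *m B) i j = B (lift k i) j.
Proof.
rewrite mxE (bigD1 (lift k i)) //= !mxE eqxx mul1r big1 ?addr0 // => l /negPf h.
by rewrite !mxE h mul0r.
Qed.

Lemma mulmx_liftr m n (k : 'I_n) (B : 'M[R]_(m, n)) i j :
  (B *m lift_mx k) i j = B i (lift k j).
Proof.
rewrite mxE (bigD1 (lift k j)) //= !mxE eqxx mulr1 big1 ?addr0 // => l /negPf h.
by rewrite !mxE h mulr0.
Qed.

Lemma diff_lift n (k : 'I_n) : diff_mx k *m lift_mx k = 1%:M.
Proof.
apply/matrixP => i j; rewrite mulmx_diff !mxE (inj_eq lift_inj).
by rewrite (negPf (neq_lift _ _)) subr0.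
Qed.

Lemma diff_mul1 n (k : 'I_n) : diff_mx k *m (const_mx 1 : 'cV[R]_n) = 0.
Proof. by apply/matrixP => i j; rewrite mulmx_diff !mxE subrr. Qed.

(** Padding after differencing is the identity minus the matrix with ones in column [k]; zero row
    sums of [B] kill the second term. *)
Lemma lift_diffE m n (k : 'I_n) (B : 'M[R]_(m, n)) :
  (forall i, \sum_j B i j = 0) -> B *m lift_mx k *m diff_mx k = B.
Proof.
move=> B0; suff E : lift_mx k *m diff_mx k = 1%:M - (\matrix_(i, j) (j == k)%:R).
  rewrite -mulmxA E mulmxBr mulmx1; apply/matrixP => i j; rewrite !mxE.
  under eq_bigr do rewrite mxE; rewrite -big_distrl /= B0 mul0r subr0 //.
apply/matrixP => i j; rewrite !mxE.
case: (unliftP k i) => [l|] ->.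
  rewrite (bigD1 l) //= !mxE eqxx mul1r big1 ?addr0 ?(eq_sym j) // => s sl.
  by rewrite mxE (inj_eq lift_inj) eq_sym (negPf sl) mul0r.
rewrite big1 ?(eq_sym k) ?subrr // => l _; rewrite mxE.
by rewrite (negPf (neq_lift _ _)) mul0r.
Qed.

(** With - Gamma / 2 in the role of a covariance, Sigma^(k) is the covariance of the differences x_i
    - x_k; the zero diagonal removes the entry at (k, k). *)
Lemma hr_SigmaE n (Gamma : 'M[R]_n) (k : 'I_n) :
  Gamma^T = Gamma -> (forall i, Gamma i i = 0) ->
  hr_Sigma Gamma k = diff_mx k *m ((- 2^-1) *: Gamma) *m (diff_mx k)^T.
Proof.
move=> Gs G0; apply/matrixP => i j.
rewrite -mulmxA mulmx_diff -(trmxK (_ *: _)) -trmx_mul [X in X - _]mxE [X in _ - X]mxE.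
rewrite !mulmx_diff !mxE G0 -[in Gamma k _]Gs mxE; ring.
Qed.

(** For symmetric [A], the transpose of [B] satisfies the same four Penrose identities, and the
    pseudo-inverse is unique. *)
Lemma moore_penrose_tr n (A B : 'M[R]_n) :
  A^T = A -> moore_penrose_inverse A B -> B^T = B.
Proof.
move=> As [h1 h2 h3 h4]; apply: (@moore_penrose_inverse_uniq _ _ _ A); last by split.
split.
- by apply: trmx_inj; rewrite !trmx_mul trmxK As mulmxA h1.
- by apply: trmx_inj; rewrite !trmx_mul trmxK As mulmxA h2.
- by rewrite -[in LHS]As -trmx_mul trmxK -h4 trmx_mul As.
- by rewrite -[in LHS]As -trmx_mul trmxK -h3 trmx_mul As.
Qed.

(** B = B (A B) = B (A B)^T = B B^T A, so whatever [A] kills, [B] kills. *)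
Lemma moore_penrose_ker n m (A B : 'M[R]_n) (v : 'M[R]_(n, m)) :
  A^T = A -> moore_penrose_inverse A B -> A *m v = 0 -> B *m v = 0.
Proof.
move=> As [h1 h2 h3 h4] Av.
by rewrite -h2 -[B *m A *m B]mulmxA -h3 trmx_mul As -!mulmxA Av !mulmx0.
Qed.

Definition centered_mx n (Gamma : 'M[R]_n) : 'M[R]_n :=
  centering_mx n *m ((- 2^-1) *: Gamma) *m centering_mx n.

(** * Kernel, minors and sign patterns of the precision matrix *)

Section precision.
Variables (n : nat) (Gamma Theta : 'M[R]_n).
Hypothesis n_gt0 : (0 < n)%N.
Hypothesis hGamma : variogram_matrix Gamma.
Hypothesis hTheta : hr_precision Gamma Theta.

Let A := centered_mx Gamma.

Let A_tr : A^T = A.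
Proof.
case: hGamma => Gs _ _.
by rewrite /A /centered_mx !trmx_mul !centering_tr linearZ /= Gs mulmxA.
Qed.

Let A_mul1 : A *m (const_mx 1 : 'cV[R]_n) = 0.
Proof. by rewrite /A /centered_mx -mulmxA centering_mul1 // mulmx0. Qed.

Lemma precision_tr : Theta^T = Theta.
Proof. exact: moore_penrose_tr A_tr hTheta. Qed.

Let Theta_mul1 : Theta *m (const_mx 1 : 'cV[R]_n) = 0.
Proof. exact: moore_penrose_ker A_tr hTheta A_mul1. Qed.

Lemma precision_sum i : \sum_j Theta i j = 0.
Proof. by rewrite -sum_row_mulmx Theta_mul1 mxE. Qed.

Let mul1_Theta : (const_mx 1 : 'rV[R]_n) *m Theta = 0.
Proof.
by rewrite -[LHS]trmxK trmx_mul precision_tr trmx_const Theta_mul1 trmx0.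
Qed.

Lemma variogram_quad_gt0 (x : 'cV[R]_n) : x != 0 ->
  (const_mx 1 : 'rV[R]_n) *m x = 0 -> 0 < quad_form ((- 2^-1) *: Gamma) x.
Proof.
move=> x0 x1; case: hGamma => _ _ /(_ x x0); rewrite -(trmx_const 1 n 1).
rewrite -trmx_mul x1 trmx0 => /(_ erefl).
by rewrite quad_form_scale mulNr oppr_gt0 pmulr_rlt0 // invr_gt0.
Qed.

Let mul1_centering : (const_mx 1 : 'rV[R]_n) *m centering_mx n = 0.
Proof.
by rewrite -[LHS]trmxK trmx_mul centering_tr trmx_const centering_mul1 ?trmx0.
Qed.

(** The form of [A] at x is that of - Gamma / 2 at the centred x, which is positive unless the
    centred x vanishes. *)
Let A_ker (x : 'cV[R]_n) : A *m x = 0 -> centering_mx n *m x = 0.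
Proof.
move=> Ax; apply/eqP; apply: contraT => y0.
have := variogram_quad_gt0 y0; rewrite mulmxA mul1_centering mul0mx => /(_ erefl).
rewrite quad_form_mulmx centering_tr -/(centered_mx _) -/A /quad_form -mulmxA Ax mulmx0 mxE.
by rewrite ltxx.
Qed.

(** From A Theta A = A, the columns of Theta A - I lie in the kernel of [A], hence are killed by
    centering. Centering fixes [Theta], whose columns sum to zero. *)
Let Theta_A : Theta *m A = centering_mx n.
Proof.
case: hTheta; rewrite -/(centered_mx _) -/A => h1 h2 h3 h4.
have cT : centering_mx n *m Theta = Theta by rewrite centeringE.
rewrite -[in LHS]cT -mulmxA; apply/matrixP => i j.
have Ac : A *m ((Theta *m A - 1%:M) *m delta_mx j (0 : 'I_1)) = 0.
  by rewrite mulmxA mulmxBr mulmx1 mulmxA h1 subrr mul0mx.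
have := A_ker Ac; rewrite mulmxA -colE mulmxBr mulmx1 => /colP /(_ i).
by rewrite mxE [X in X = _]mxE [X in _ + X]mxE [X in _ = X]mxE => /subr0_eq.
Qed.

(** Transposing [Theta_A] writes centering as A Theta, so the kernel of [Theta] lies in that of
    centering. *)
Lemma precision_ker (x : 'cV[R]_n) : Theta *m x = 0 -> forall i j, x i 0 = x j 0.
Proof.
move=> Tx; apply: centering_eq0.
by rewrite -centering_tr -Theta_A trmx_mul A_tr precision_tr -mulmxA Tx mulmx0.
Qed.

Let diff_tr_centering k : centering_mx n *m (diff_mx k)^T = (diff_mx k)^T.
Proof. by rewrite centeringE // -(trmx_const n 1 1) -trmx_mul diff_mul1 trmx0. Qed.

Let hr_SigmaA k : hr_Sigma Gamma k = diff_mx k *m A *m (diff_mx k)^T.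
Proof.
case: hGamma => Gs G0 _; rewrite hr_SigmaE // /A /centered_mx !mulmxA.
rewrite -[in RHS]mulmxA diff_tr_centering.
suff -> : diff_mx k *m centering_mx n = diff_mx k by [].
by rewrite -[LHS]trmxK trmx_mul centering_tr diff_tr_centering trmxK.
Qed.

(** Write L for [lift_mx k] and D for [diff_mx k]. The product is L^T (Theta L D) A D^T = L^T Theta
    A D^T; Theta A is centering, which fixes D^T, and L^T D^T = I. *)
Let minor_Sigma k :
  (lift_mx k)^T *m Theta *m lift_mx k *m hr_Sigma Gamma k = 1%:M.
Proof.
have TLD := lift_diffE k precision_sum.
transitivity ((lift_mx k)^T *m (Theta *m lift_mx k *m diff_mx k) *m A *m
  (diff_mx k)^T); first by rewrite hr_SigmaA !mulmxA.
rewrite TLD -(mulmxA _ Theta A) Theta_A -mulmxA diff_tr_centering.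
by rewrite -trmx_mul diff_lift trmx1.
Qed.

Lemma hr_Sigma_unit k : hr_Sigma Gamma k \in unitmx.
Proof. by have [] := mulmx1_unit (minor_Sigma k). Qed.

Lemma hr_ThetaE k : hr_Theta Gamma k = (lift_mx k)^T *m Theta *m lift_mx k.
Proof.
by rewrite /hr_Theta -[RHS]mulmx1 -(mulmxV (hr_Sigma_unit k)) mulmxA minor_Sigma mul1mx.
Qed.

Lemma quad_form_hr_Theta k (x : 'cV[R]_n) :
  quad_form (hr_Theta Gamma k) (diff_mx k *m x) = quad_form Theta x.
Proof.
rewrite quad_form_mulmx hr_ThetaE; congr (quad_form _ x).
have TLD := lift_diffE k precision_sum.
transitivity ((Theta *m lift_mx k *m diff_mx k)^T *m lift_mx k *m diff_mx k).
  by rewrite !trmx_mul precision_tr !mulmxA.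
by rewrite TLD precision_tr TLD.
Qed.

Lemma hr_Theta_coef k i j : hr_Theta Gamma k i j = Theta (lift k i) (lift k j).
Proof. by rewrite hr_ThetaE mulmx_liftr mulmx_liftl. Qed.

(** The form is that of - Gamma / 2 at D^T x with D = [diff_mx k]. This vector sums to zero, and it
    is nonzero because D has a right inverse. *)
Lemma hr_Sigma_posdef k : posdef (hr_Sigma Gamma k).
Proof.
have [Gs G0 _] := hGamma; rewrite hr_SigmaE //; split=> [|x x0].
  by rewrite !trmx_mul trmxK linearZ /= Gs mulmxA.
rewrite -{1}(trmxK (diff_mx k)) -quad_form_mulmx; apply: variogram_quad_gt0.
  apply: contraNneq x0 => Dx.
  by rewrite -[x]mul1mx -trmx1 -(diff_lift k) trmx_mul -mulmxA Dx mulmx0.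
by rewrite mulmxA -(trmx_const n 1 1) -trmx_mul diff_mul1 trmx0 mul0mx.
Qed.

Lemma hr_Theta_posdef k : posdef (hr_Theta Gamma k).
Proof.
have [Ss Spos] := hr_Sigma_posdef k.
have Su := hr_Sigma_unit k.
split=> [|x x0]; first by rewrite /hr_Theta trmx_inv Ss.
have -> : quad_form (hr_Theta Gamma k) x =
    quad_form (hr_Sigma Gamma k) (hr_Theta Gamma k *m x).
  by rewrite quad_form_mulmx /hr_Theta trmx_inv Ss mulVmx // mul1mx.
apply: Spos; apply: contraNneq x0 => Tx.
by rewrite -[x]mul1mx -(mulmxV Su) -mulmxA Tx mulmx0.
Qed.

Lemma quad_form_precision_ge0 (x : 'cV[R]_n) : 0 <= quad_form Theta x.
Proof.
pose k := Ordinal n_gt0; rewrite -(quad_form_hr_Theta k).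
have [-> |] := eqVneq (diff_mx k *m x) 0; first by rewrite /quad_form mulmx0 mxE.
by case: (hr_Theta_posdef k) => _ /[apply] /ltW.
Qed.

Lemma precision_diag_ge0 i : 0 <= Theta i i.
Proof.
have := quad_form_precision_ge0 (delta_mx i 0).
rewrite quad_formE (bigD1 i) //= (bigD1 i) //= !mxE !eqxx !mulr1.
rewrite big1 ?addr0 => [|j /negPf h]; last first.
  by rewrite !mxE h mulr0 mulr0.
by rewrite big1 ?addr0 // => j /negPf h; rewrite big1 // => l _; rewrite !mxE h mul0r mulr0.
Qed.

(** The indicator of the component of i is in the kernel: a row inside the component gives its full
    row sum, a row outside meets no entry of the component. Kernel vectors are constant, so the
    component is everything. *)
Lemma precision_connected : (forall i j, i != j -> Theta i j <= 0) ->
  connected_laplacian Theta.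
Proof.
move=> T0; split=> //; [exact: precision_tr|exact: precision_sum|] => i j.
set e := (X in fingraph.connect X).
have esym : symmetric e.
  by move=> a b; rewrite /e /= eq_sym -[in LHS]precision_tr mxE.
pose x : 'cV[R]_n := \col_l (fingraph.connect e i l)%:R.
have Tx : Theta *m x = 0.
  apply/colP => r; rewrite mxE [RHS]mxE.
  have [ir|ir] := boolP (fingraph.connect e i r).
    rewrite -[RHS](precision_sum r); apply: eq_bigr => l _; rewrite mxE.
    have [->|rl] := eqVneq l r; first by rewrite ir mulr1.
    have [->|Trl] := eqVneq (Theta r l) 0; first by rewrite mul0r.
    suff -> : fingraph.connect e i l by rewrite mulr1.
    by apply: connect_trans ir (connect1 _); rewrite /e /= eq_sym rl.
  apply: big1 => l _; rewrite mxE.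
  have [il|] := boolP (fingraph.connect e i l); last by rewrite mulr0.
  have [->|Trl] := eqVneq (Theta r l) 0; first by rewrite mul0r.
  case/negP: (ir); apply: (connect_trans il); rewrite connect1 // esym /e /= Trl andbT.
  by apply: contraNneq ir => ->.
have := precision_ker Tx i j; rewrite !mxE connect0.
by case: fingraph.connect => // /eqP; rewrite oner_eq0.
Qed.

(** Since rows of [Theta] sum to zero, deleting column [k] leaves the row sum - Theta_ik, which is
    nonnegative. *)
Lemma precision_le0_dd : (forall i j, i != j -> Theta i j <= 0) ->
  forall k, dd_M_matrix (hr_Theta Gamma k).
Proof.
move=> T0 k; split; first split; first exact: hr_Theta_posdef.
  by move=> i j ij; rewrite hr_Theta_coef T0 // (inj_eq lift_inj).
move=> i; under eq_bigr do rewrite hr_Theta_coef.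
have := precision_sum (lift k i); rewrite (bigD1_ord k) //= => /eqP.
by rewrite addrC addr_eq0 => /eqP ->; rewrite oppr_ge0 T0 // eq_sym neq_lift.
Qed.

Lemma M_matrix_precision_le0 : (forall k, M_matrix (hr_Theta Gamma k)) ->
  forall i j, i != j -> Theta i j <= 0.
Proof.
move=> HM i j ij.
have [/existsP[k /andP[ki kj]]|nk] := boolP [exists k, (k != i) && (k != j)].
  case: (unliftP k i) ki => [i' ii' _|->]; last by rewrite eqxx.
  case: (unliftP k j) kj => [j' jj' _|->]; last by rewrite eqxx.
  rewrite ii' jj' -hr_Theta_coef; apply: (HM k).2.
  by apply: contraNneq ij => e; rewrite ii' jj' e.
(* Without a third index, i and j are the only ones, no minor contains the entry, and the zero row
   sum gives Theta_ij = - Theta_ii. *)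
have := precision_sum i; rewrite (bigD1 i) //= (bigD1 j) 1?eq_sym //= big1.
  rewrite addr0 => /eqP; rewrite addrC addr_eq0 => /eqP ->.
  by rewrite oppr_le0 precision_diag_ge0.
move=> l /andP[li lj]; case/existsP: nk; exists l; by rewrite li.
Qed.

(** Diagonal dominance supplies the signs in row and column [k], which the minor does not contain:
    its row sums are - Theta_ik. *)
Lemma dd_M_matrix_precision_le0 k : dd_M_matrix (hr_Theta Gamma k) ->
  forall i j, i != j -> Theta i j <= 0.
Proof.
move=> [[_ HM] Hd].
have Tk i : Theta (lift k i) k <= 0.
  have := precision_sum (lift k i); rewrite (bigD1_ord k) //= => /eqP.
  rewrite addr_eq0 => /eqP ->; rewrite oppr_le0.
  by under eq_bigr do rewrite -hr_Theta_coef.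
move=> i j; case: (unliftP k i) => [i'|] ->; case: (unliftP k j) => [j'|] -> //.
- by rewrite (inj_eq lift_inj) -hr_Theta_coef; apply: HM.
- by move=> _; rewrite -precision_tr mxE.
- by rewrite eqxx.
Qed.

End precision.
End linear_algebra.

(** * Lebesgue measure on tuples *)

Section lebesgue_tuple_theory.
Context {R : realType}.

Definition box n (A : 'I_n -> set R) : set (n.-tuple R) :=
  [set t | forall i, A i (tnth t i)].

Lemma measurable_box n (A : 'I_n -> set R) :
  (forall i, measurable (A i)) -> measurable (box A).
Proof.
move=> mA; rewrite (_ : box A = \bigcap_(i in [set: 'I_n])
    (setT `&` (@tnth n R ^~ i) @^-1` A i)).
  by apply: fin_bigcap_measurable => // i _; exact: measurable_tnth.
apply/seteqP; split=> t /= tA i; first by split=> //; exact: tA.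
by have [] := tA i I.
Qed.

Lemma measurable_tupleE n : @measurable _ (n.-tuple R) =
  <<s [set X | exists2 A : 'I_n -> set R, (forall i, measurable (A i)) & X = box A] >>.
Proof.
apply/seteqP; split; apply: smallest_sub.
- exact: smallest_sigma_algebra.
- move=> X; rewrite -bigcup_seq => -[i _ [B mB <-]]; apply: sub_sigma_algebra.
  exists (fun j => if j == i then B else setT) => [j|]; first by case: ifP.
  rewrite setTI; apply/seteqP; split=> t /= tB; last by have := tB i; rewrite eqxx.
  by move=> j; case: eqP => // ->.
- exact: sigma_algebra_measurable.
- by move=> X [A mA ->]; exact: measurable_box.
Qed.

(** Boxes are a generating pi-system, and cubes of finite measure exhaust the space. *)
Lemma lebesgue_tuple_unique n (mu : {measure set (n.-tuple R) -> \bar R}) :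
  (forall A : 'I_n -> set R, (forall i, measurable (A i)) ->
    mu (box A) = (\prod_(i < n) lebesgue_measure (A i))%E) ->
  forall A, measurable A -> lebesgue_tuple n A = mu A.
Proof.
move=> muE; apply: (measure_unique _
  (fun k => box (fun i : 'I_n => `[- k%:R, k%:R]%classic)) (measurable_tupleE n)).
- move=> _ _ [A mA ->] [B mB ->]; exists (fun i => A i `&` B i).
    by move=> i; exact: measurableI.
  apply/seteqP; split=> t /=; first by move=> [tA tB] i; split.
  by move=> tAB; split=> i; have [] := tAB i.
- by move=> k; exists (fun=> `[- k%:R, k%:R]%classic).
- apply/seteqP; split=> // t _.
  (* The sum of the integer bounds dominates each of them, so a single cube contains [t]. *)
  exists (\sum_(i < n) Num.bound `|tnth t i|)%N => // i /=.
  rewrite in_itv /= -ler_norml (le_trans (ltW (archi_boundP (normr_ge0 _)))) // ler_nat.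
  by rewrite (bigD1 i) //= leq_addr.
- by move=> _ [A mA ->]; rewrite muE // -lebesgue_tuple_box.
- move=> k; rewrite [X in (X < _)%E]lebesgue_tuple_box //.
  rewrite ltey_eq; apply/orP; left; elim/big_ind: _ => // [|i _]; first exact: fin_numM.
  by rewrite lebesgue_measure_itv; case: ifP.
Qed.

Lemma lebesgue_measure_shift (a : R) (A : set R) : measurable A ->
  lebesgue_measure [set x | A (x + a)] = lebesgue_measure A.
Proof.
move=> mA; rewrite (_ : [set x | A (x + a)] = (fun x : R => x + a) @^-1` A) //.
have ma : measurable_fun [set: measurableTypeR R]
    (fun x : measurableTypeR R => x + a : measurableTypeR R).
  by apply: measurable_funD.
apply/esym; apply: (@lebesgue_measure_unique R (pushforward lebesgue_measure
  (fun x : measurableTypeR R => x + a : measurableTypeR R))) => //.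
move=> _ [[b c]] _ <-.
rewrite /= /pushforward.
rewrite (_ : _ @^-1` _ = `]b - a, c - a]%classic).
  rewrite !lebesgue_measure_itv /= !lte_fin ltrD2r; case: ifP => // _.
  by rewrite -!EFinB; congr EFin; ring.
by apply/seteqP; split=> x /=; rewrite !in_itv /= ltrBlDr lerBrDr.
Qed.

Lemma tnth_shift n (x : n.-tuple R) a i : tnth (Defs.shift x a) i = tnth x i + a.
Proof. exact: tnth_mktuple. Qed.

Lemma tnth_remove n (k : 'I_n) (x : n.-tuple R) i :
  tnth (remove k x) i = tnth x (lift k i).
Proof. exact: tnth_mktuple. Qed.

Definition add_tuple n (v x : n.-tuple R) := [tuple tnth x i + tnth v i | i < n].

Lemma measurable_add_tuple n (v : n.-tuple R) : measurable_fun setT (add_tuple v).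
Proof.
apply/measurable_fun_tnthP => i.
rewrite (_ : _ \o _ = (fun x => tnth x i + tnth v i)).
  by apply: measurable_funD => //; exact: measurable_tnth.
by apply/funext => x /=; rewrite tnth_mktuple.
Qed.

Lemma lebesgue_tuple_translation n (v : n.-tuple R) A : measurable A ->
  lebesgue_tuple n (add_tuple v @^-1` A) = lebesgue_tuple n A.
Proof.
move=> mA; apply/esym.
apply: (@lebesgue_tuple_unique n (pushforward (lebesgue_tuple n) (add_tuple v))) => //.
  exact: measurable_add_tuple.
move=> mv B mB; rewrite /= /pushforward.
rewrite (_ : _ @^-1` _ = box (fun i => [set x | B i (x + tnth v i)])).
  rewrite [LHS]lebesgue_tuple_box.
    by apply: eq_bigr => i _; exact: lebesgue_measure_shift.
  move=> i; rewrite -[X in measurable X]setTI. 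
  by apply: (measurable_funD _ (measurable_cst _)).
by apply/seteqP; split=> x /= h i; have := h i; rewrite tnth_mktuple.
Qed.

(* The point with k-th coordinate e and other coordinates w_j + e. *)
Definition spread n (k : 'I_n.+1) (p : R * n.-tuple R) : n.+1.-tuple R :=
  [tuple (if unlift k i is Some j then tnth p.2 j else 0) + p.1 | i < n.+1].

Lemma measurable_spread n (k : 'I_n.+1) : measurable_fun setT (spread k).
Proof.
apply/measurable_fun_tnthP => i.
rewrite (_ : _ \o _ = (fun p => (if unlift k i is Some j then tnth p.2 j else 0) + p.1)).
  apply: measurable_funD => //; case: unlift => [j|] //.
  exact: (measurableT_comp (measurable_tnth (j : 'I_n)) measurable_snd).
by apply/funext => x /=; rewrite tnth_mktuple.
Qed.

Lemma tnth_spread_self n (k : 'I_n.+1) (p : R * n.-tuple R) :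
  tnth (spread k p) k = p.1.
Proof. by rewrite tnth_mktuple unlift_none add0r. Qed.

Lemma tnth_spread_lift n (k : 'I_n.+1) (p : R * n.-tuple R) j :
  tnth (spread k p) (lift k j) = tnth p.2 j + p.1.
Proof. by rewrite tnth_mktuple liftK. Qed.

(** By uniqueness on boxes it suffices to integrate the measures of the sections over the coordinate
    [e]. *)
Lemma lebesgue_tuple_spread n (k : 'I_n.+1) A : measurable A ->
  (lebesgue_measure \x lebesgue_tuple n)%E (spread k @^-1` A) = lebesgue_tuple n.+1 A.
Proof.
move=> mA; apply/esym.
apply: (@lebesgue_tuple_unique n.+1
  (pushforward (lebesgue_measure \x lebesgue_tuple n)%E (spread k))) => //.
  exact: measurable_spread.
move=> mv B mB; rewrite /= /pushforward /product_measure1.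
(* For [e] in [B k] the section is a translated box, of measure independent of [e]; for other [e] it
   is empty. *)
have -> : (fun x => lebesgue_tuple n (xsection (spread k @^-1` box B) x)) =
  (cst (\prod_(j < n) lebesgue_measure (B (lift k j)))%E) \_ (B k).
  apply/funext => e; rewrite patchE; case: ifPn => [|] Be.
    transitivity (lebesgue_tuple n (box (fun j => [set x | B (lift k j) (x + e)]))).
      congr (lebesgue_tuple n _); apply/seteqP; split=> w /=; rewrite /xsection /= ?inE /=.
        by move=> h j; have := h (lift k j); rewrite tnth_mktuple liftK.
      move=> h i; rewrite tnth_mktuple; case: (unliftP k i) => [j|] -> /=; first exact: h.
      by rewrite add0r; exact/set_mem.
    rewrite [LHS]lebesgue_tuple_box.
      by apply: eq_bigr => j _; exact: lebesgue_measure_shift.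
    move=> j; rewrite -[X in measurable X]setTI. 
    by apply: (measurable_funD _ (measurable_cst _)).
  rewrite (_ : xsection _ _ = set0) ?measure0 //.
  apply/seteqP; split=> w //=; rewrite /xsection /= inE /= => /(_ k).
  by rewrite tnth_mktuple unlift_none add0r => /mem_set; exact/negP.
rewrite -integral_mkcond [LHS]integral_cst; last exact: mB.
rewrite muleC.
by rewrite [RHS](bigD1_ord k).
Qed.
End lebesgue_tuple_theory.

(** * Densities *)

Section density_measure.
Context d (T : measurableType d) (R : realType) (mu : {measure set T -> \bar R}).
Variable f : T -> R.
Hypothesis mf : measurable_fun setT f.
Hypothesis f_ge0 : forall x, 0 <= f x.

(** Packaged as a measure so that uniqueness on a pi-system applies to laws given by densities. *)
Definition density_measure (A : set T) : \bar R := (\int[mu]_(x in A) (f x)%:E)%E.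

Let density0 : density_measure set0 = 0%E.
Proof. exact: integral_set0. Qed.

Let density_ge0 A : (0 <= density_measure A)%E.
Proof. by apply: integral_ge0 => x _; rewrite lee_fin. Qed.

Let density_sigma_additive : semi_sigma_additive density_measure.
Proof.
move=> /= F mF tF mUF; rewrite /density_measure; apply: cvg_toP.
  apply: ereal_nondecreasing_is_cvgn => m n mn.
  by apply: lee_sum_nneg_natr => // k _ _; exact: density_ge0.
rewrite ge0_integral_bigcup //.
- by apply: measurable_funTS; exact/measurable_EFinP.
- by move=> x _; rewrite lee_fin.
Qed.

HB.instance Definition _ := isMeasure.Build _ _ _
  density_measure density0 density_ge0 density_sigma_additive.

End density_measure.

Section product_density.
Local Open Scope ereal_scope.
Context d1 d2 (T1 : measurableType d1) (T2 : measurableType d2) (R : realType).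

Lemma finite_measure_rect_unique (mu nu : {measure set (T1 * T2) -> \bar R}) :
  (forall A B, measurable A -> measurable B -> mu (A `*` B) = nu (A `*` B)) ->
  mu setT < +oo -> forall X, measurable X -> mu X = nu X.
Proof.
move=> mn muoo; apply: (measure_unique _ (fun=> setT) (measurable_prod_measurableType _ _)).
- move=> _ _ [A mA [B mB <-]] [C mC [D mD <-]]; rewrite -setXI.
  by exists (A `&` C); [exact: measurableI|exists (B `&` D); [exact: measurableI|]].
- by move=> _; exists setT => //; exists setT => //; rewrite setXTT.
- by rewrite bigcup_const.
- by move=> _ [A mA [B mB <-]]; exact: mn.
- by [].
Qed.

Variables (m1 : {sigma_finite_measure set T1 -> \bar R}).
Variables (m2 : {sigma_finite_measure set T2 -> \bar R}).
Variables (f : T1 -> R) (g : T2 -> R).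
Hypothesis mf : measurable_fun setT f.
Hypothesis mg : measurable_fun setT g.
Hypothesis f_ge0 : (forall x, 0 <= f x)%R.
Hypothesis g_ge0 : (forall x, 0 <= g x)%R.

Lemma measurable_prod_density : measurable_fun setT (fun p : T1 * T2 => f p.1 * g p.2)%R.
Proof. by apply: measurable_funM; exact: measurableT_comp. Qed.

(** Tonelli, after absorbing the indicators of [A] and [B] into the two factors. *)
Lemma integral_prod_density A B : measurable A -> measurable B ->
  \int[m1 \x m2]_(p in A `*` B) (f p.1 * g p.2)%:E =
  \int[m1]_(x in A) (f x)%:E * \int[m2]_(y in B) (g y)%:E.
Proof.
move=> mA mB.
have mfE : measurable_fun setT (EFin \o f) by exact/measurable_EFinP.
have mgE : measurable_fun setT (EFin \o g) by exact/measurable_EFinP.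
have mfA : measurable_fun setT ((EFin \o f) \_ A).
  by apply/(measurable_restrictT _ _).1 => //; exact: measurable_funTS.
have mgB : measurable_fun setT ((EFin \o g) \_ B).
  by apply/(measurable_restrictT _ _).1 => //; exact: measurable_funTS.
have fA0 x : 0 <= ((EFin \o f) \_ A) x by rewrite patchE; case: ifP; rewrite ?lee_fin.
have gB0 x : 0 <= ((EFin \o g) \_ B) x by rewrite patchE; case: ifP; rewrite ?lee_fin.
rewrite integral_mkcond fubini_tonelli1; first last.
- by move=> p; rewrite patchE; case: ifP => //= _; rewrite lee_fin mulr_ge0.
- apply/(measurable_restrictT _ _).1; first exact: measurableX.
  by apply: measurable_funTS; apply/measurable_EFinP; exact: measurable_prod_density.
rewrite [in RHS]integral_mkcond [X in _ * X]integral_mkcond.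
rewrite -ge0_integralZr //; last exact: integral_ge0.
apply: eq_integral => x _; rewrite /fubini_F -ge0_integralZl //.
apply: eq_integral => y _; rewrite !patchE in_setX /=.
by case: (x \in A); case: (y \in B); rewrite ?mule0 ?mul0e //= EFinM.
Qed.

End product_density.

(** Both sets have the same union with the exceptional null set. Only a measurable superset of the
    disagreement is at hand, hence the unions. *)
Lemma ae_measure_eq d (T : measurableType d) (R : realType)
    (mu : {measure set T -> \bar R}) (A B : set T) :
  measurable A -> measurable B -> {ae mu, forall x, A x <-> B x} -> mu A = mu B.
Proof.
move=> mA mB [N [mN muN0 subN]].
have nN := (null_setU mu mN).1 ((measure0_null_setP mu mN).2 muN0).
rewrite -(nN _ mA) -(nN _ mB); congr (mu _).
have AB x : ~ N x -> A x <-> B x by move=> nNx; apply: contrapT => h; apply: nNx; exact: subN.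
apply/seteqP; split=> x; have [Nx _|/AB ABx [/ABx|]] := pselect (N x);
  by [right|left|right].
Qed.

(** * The density of the shifted vector W + E 1 *)

Section uniqueness.
Context {R : realType}.

Lemma measurable_remove n (k : 'I_n.+1) :
  measurable_fun setT (fun x : n.+1.-tuple R => remove k x : n.-tuple R).
Proof.
apply/measurable_fun_tnthP => i.
rewrite (_ : _ \o _ = (fun x => tnth x (lift k i))); first exact: measurable_tnth.
by apply/funext => x /=; exact: (tnth_remove k x i).
Qed.

Lemma measurable_shift d (T : measurableType d) n (h : T -> n.-tuple R) (a : T -> R) :
  measurable_fun setT h -> measurable_fun setT a ->
  measurable_fun setT (fun x => Defs.shift (h x) (a x)).
Proof.
move=> mh ma; apply/measurable_fun_tnthP => i.
rewrite (_ : _ \o _ = (fun x => tnth (h x) i + a x)).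
  by apply: measurable_funD => //; exact: (measurableT_comp (measurable_tnth i)).
by apply/funext => x /=; exact: tnth_shift.
Qed.

(** Independence gives the identity on rectangles, and these determine a finite measure. *)
Lemma joint_density d (T : measurableType d) (Q : probability T R) n
    (W : {RV Q >-> n.+1.-tuple R}) (E : {RV Q >-> R}) (k : 'I_n.+1)
    (phi : n.-tuple R -> R) :
  (forall A : set R, measurable A -> Q (E @^-1` A) = exponential_prob 1 A) ->
  independent W E ->
  has_density (fun A => Q [set w | A (remove k (W w))]) phi ->
  forall X : set (R * n.-tuple R), measurable X ->
  Q [set w | X (E w, remove k (W w))] =
  (\int[lebesgue_measure \x lebesgue_tuple n]_(p in X)
    (exponential_pdf 1 p.1 * phi p.2)%:E)%E.
Proof.
move=> QE WE [mphi phi0 Qphi].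
have mr := measurable_remove k.
have mrW : measurable_fun setT (fun w => (E w, remove k (W w) : n.-tuple R)).
  apply/measurable_fun_pairP; split => /=; first exact: measurable_funP.
  exact: measurableT_comp mr (measurable_funP W).
have mpdf : measurable_fun setT (exponential_pdf 1 : R -> R) by exact: measurable_exponential_pdf.
have pdf0 (x : R) : 0 <= exponential_pdf 1 x by exact: exponential_pdf_ge0.
have mG := measurable_prod_density mpdf mphi.
move=> X mX.
have G0 (p : R * n.-tuple R) : 0 <= exponential_pdf 1 p.1 * phi p.2 by exact: mulr_ge0.
change (@pushforward _ _ T (measurableTypeR R * n.-tuple R)%type R Q
    (fun w => (E w, remove k (W w) : n.-tuple R)) X =
  density_measure (lebesgue_measure \x lebesgue_tuple n)%E
    (fun p : R * n.-tuple R => exponential_pdf 1 p.1 * phi p.2) X).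
unshelve refine (@finite_measure_rect_unique _ _ (measurableTypeR R) _ R _ _ _ _ X mX).
- exact: mrW.
- exact: mG.
- exact: G0.
  move=> A B mA mB; rewrite /= /pushforward /density_measure.
  rewrite (@integral_prod_density _ _ (measurableTypeR R) _ R lebesgue_measure
    (lebesgue_tuple n) (exponential_pdf 1) phi) //.
  rewrite -[X in (X * _)%E]QE // -Qphi // muleC.
  have mB' : measurable (remove k @^-1` B) by rewrite -[X in measurable X]setTI; exact: mr.
  rewrite -[RHS](WE _ _ mB' mA); congr (Q _).
  by apply/seteqP; split=> w [].
by rewrite /= /pushforward preimage_setT probability_setT ltry.
Qed.

Lemma spread_remove n (k : 'I_n.+1) (x : n.+1.-tuple R) e : tnth x k = 0 ->
  Defs.shift x e = spread k (e, remove k x).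
Proof.
move=> xk; apply: eq_from_tnth => i; rewrite tnth_shift.
case: (unliftP k i) => [j|] ->.
  by rewrite (tnth_spread_lift k (e, remove k x) j) (tnth_remove k x j).
by rewrite (tnth_spread_self k (e, remove k x)) xk add0r.
Qed.

(** As W_k = 0 almost surely, W + E 1 is the image under [spread k] of E and the remaining
    coordinates of W, and [spread k] carries the product measure to Lebesgue measure. *)
Lemma shifted_density d (T : measurableType d) (Q : probability T R) n
    (W : {RV Q >-> n.+1.-tuple R}) (E : {RV Q >-> R}) (k : 'I_n.+1)
    (phi : n.-tuple R -> R) :
  (forall A : set R, measurable A -> Q (E @^-1` A) = exponential_prob 1 A) ->
  independent W E ->
  {ae Q, forall w, tnth (W w) k = 0} ->
  has_density (fun A => Q [set w | A (remove k (W w))]) phi ->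
  has_density (fun A => Q [set w | A (Defs.shift (W w) (E w))])
    (fun y => exponential_pdf 1 (tnth y k) *
       phi (remove k (Defs.shift y (- tnth y k)))).
Proof.
move=> QE WE Wk0 dW; have [mphi phi0 Qphi] := dW.
set f := (X in has_density _ X).
have fE p : f (spread k p) = exponential_pdf 1 p.1 * phi p.2.
  rewrite /f tnth_spread_self; congr (_ * phi _); apply: eq_from_tnth => j.
  by rewrite (tnth_remove k _ j) tnth_shift tnth_spread_lift addrK.
have mf : measurable_fun setT f.
  apply: measurable_funM.
    apply: measurableT_comp; first exact: measurable_exponential_pdf.
    exact: measurable_tnth.
  apply: measurableT_comp mphi _; apply: measurableT_comp (measurable_remove k) _.
  apply: measurable_shift => //; apply: measurableT_comp => //.
  exact: measurable_tnth.
have f0 x : 0 <= f x.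
  by apply: mulr_ge0 => //; exact: exponential_pdf_ge0.
split=> // A mA.
have msp : measurable (spread k @^-1` A).
  by rewrite -[X in measurable X]setTI; exact: measurable_spread.
have mL : measurable [set w | A (Defs.shift (W w) (E w))].
  rewrite -[X in measurable X]setTI; apply: measurable_shift => //; exact: measurable_funP.
have mRt : measurable [set w | (spread k @^-1` A) (E w, remove k (W w))].
  rewrite -[X in measurable X]setTI.
  apply: (_ : measurable_fun setT (fun w => (E w, remove k (W w) : n.-tuple R))) => //.
  apply/measurable_fun_pairP; split => /=; first exact: measurable_funP.
  exact: measurableT_comp (measurable_remove k) (measurable_funP W).
transitivity (Q [set w | (spread k @^-1` A) (E w, remove k (W w))]).
  apply: ae_measure_eq => //; apply: filterS Wk0 => w Wk.
  by rewrite /= (spread_remove _ Wk).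
rewrite (joint_density QE WE dW) //.
under eq_integral do rewrite -fE.
(* Change of variables along [spread k]; the image measure is then replaced by [lebesgue_tuple]. *)
have pushE := @ge0_integral_pushforward _ _ (measurableTypeR R * n.-tuple R)%type
  (n.+1.-tuple R) R (spread k) (measurable_spread k)
  (lebesgue_measure \x lebesgue_tuple n)%E A (EFin \o f) mA.
apply: etrans (esym (pushE _ _)) _.
- by apply: measurable_funTS; exact/measurable_EFinP.
- by move=> y _; rewrite lee_fin.
- apply: eq_measure_integral => [|? B mB _]; first exact: measurable_spread.
  exact: lebesgue_tuple_spread.
Qed.
End uniqueness.

(** * The MTP2 property *)

Section log_quadratic.
Context {R : realType}.

(** The hyperplane y_k = 0 is included to match [exponential_pdf], which is positive at 0. *)
Definition log_quadratic n (k : 'I_n) (Theta : 'M[R]_n) (K : R) (b : 'rV[R]_n)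
    (y : n.-tuple R) : R :=
  if 0 <= tnth y k
  then K * expR (- (quad_form Theta (vec y) / 2) + (b *m vec y) 0 0) else 0.

Lemma tnth_vmax n (x y : n.-tuple R) i :
  tnth (vmax x y) i = Num.max (tnth x i) (tnth y i).
Proof. exact: tnth_mktuple. Qed.

Lemma tnth_vmin n (x y : n.-tuple R) i :
  tnth (vmin x y) i = Num.min (tnth x i) (tnth y i).
Proof. exact: tnth_mktuple. Qed.

Lemma tnth_add_tuple n (v x : n.-tuple R) i :
  tnth (add_tuple v x) i = tnth x i + tnth v i.
Proof. exact: tnth_mktuple. Qed.

Lemma vec_add n (v x : n.-tuple R) : vec (add_tuple v x) = vec x + vec v.
Proof. by apply/colP => i; rewrite !mxE tnth_add_tuple. Qed.

Lemma vec_max_min n (x y : n.-tuple R) :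
  vec (vmax x y) + vec (vmin x y) = vec x + vec y.
Proof.
apply/colP => i; rewrite !mxE tnth_vmax tnth_vmin.
by rewrite addrC addr_min_max.
Qed.

(** Rearrangement: sorting both pairs the same way can only increase the sum of products. *)
Lemma max_min_cross (a b c e : R) :
  a * b + c * e <= Num.max a c * Num.max b e + Num.min a c * Num.min b e.
Proof.
case: (leP a c) => ac; case: (leP b e) => be; nra.
Qed.

(** Entry by entry: off the diagonal a nonpositive coefficient reverses the rearrangement
    inequality, and diagonal terms are unchanged. *)
Lemma quad_form_max_min n (Theta : 'M[R]_n) (x y : n.-tuple R) :
  (forall i j, i != j -> Theta i j <= 0) ->
  quad_form Theta (vec (vmax x y)) + quad_form Theta (vec (vmin x y)) <=
  quad_form Theta (vec x) + quad_form Theta (vec y).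
Proof.
move=> T0; rewrite !quad_formE -!big_split; apply: ler_sum => i _ /=.
rewrite -!big_split; apply: ler_sum => j _ /=.
rewrite -!mulrDr !mxE !tnth_vmax !tnth_vmin.
have [->|/T0 Tij] := eqVneq i j; last by rewrite ler_wnM2l // max_min_cross.
by rewrite le_eqVlt; apply/orP; left; apply/eqP; case: leP => _; ring.
Qed.

Definition bilin_form n (A : 'M[R]_n) (u v : 'cV[R]_n) : R := (u^T *m A *m v) 0 0.

Lemma bilin_formDr n (A : 'M[R]_n) u v w :
  bilin_form A u (v + w) = bilin_form A u v + bilin_form A u w.
Proof. by rewrite /bilin_form mulmxDr mxE. Qed.

Lemma bilin_formC n (A : 'M[R]_n) u v : A^T = A ->
  bilin_form A u v = bilin_form A v u.
Proof.
move=> As; rewrite /bilin_form; transitivity ((u^T *m A *m v)^T 0 0).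
  by rewrite [RHS]mxE.
by rewrite !trmx_mul trmxK As mulmxA.
Qed.

Lemma quad_formD n (A : 'M[R]_n) u v : A^T = A ->
  quad_form A (u + v) = quad_form A u + quad_form A v + 2 * bilin_form A u v.
Proof.
move=> As; have -> : 2 * bilin_form A u v = bilin_form A u v + bilin_form A v u.
  by rewrite [bilin_form A v u]bilin_formC // mulrDl mul1r.
rewrite /quad_form /bilin_form [(u + v)^T]linearD /= !mulmxDl !mulmxDr !mxE; ring.
Qed.

Lemma bilin_form_delta n (A : 'M[R]_n) i j :
  bilin_form A (delta_mx i 0) (delta_mx j 0) = A i j.
Proof. by rewrite /bilin_form trmx_delta -rowE -colE !mxE. Qed.


Lemma log_quadratic_MTP2 n (k : 'I_n) (Theta : 'M[R]_n) K b :
  0 < K -> (forall i j, i != j -> Theta i j <= 0) ->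
  forall x y, log_quadratic k Theta K b x * log_quadratic k Theta K b y <=
    log_quadratic k Theta K b (vmax x y) * log_quadratic k Theta K b (vmin x y).
Proof.
move=> K0 T0 x y; have Tq := quad_form_max_min x y T0.
have ge0 z : 0 <= log_quadratic k Theta K b z.
  by rewrite /log_quadratic; case: ifP => // _; rewrite mulr_ge0 ?expR_ge0 ?ltW.
rewrite {1 2}/log_quadratic; case: ifPn => xk; last by rewrite mul0r mulr_ge0.
case: ifPn => yk; last by rewrite mulr0 mulr_ge0.
(* The half-space is stable under maximum and minimum, so all four values are exponentials and only
   exponents need comparing; their linear parts cancel. *)
rewrite /log_quadratic tnth_vmax tnth_vmin le_max le_min xk yk /=.
rewrite mulrACA [leRHS]mulrACA -!expRD ler_pM2l ?mulr_gt0 // ler_expR.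
rewrite addrACA [leRHS]addrACA.
have -> : (b *m vec (vmax x y)) 0 0 + (b *m vec (vmin x y)) 0 0 =
    (b *m vec x) 0 0 + (b *m vec y) 0 0.
  have := congr1 (fun v => (b *m v) 0 0) (vec_max_min x y).
  by rewrite /= !mulmxDr !mxE.
by rewrite lerD2r; lra.
Qed.

(** Nonnegative steps from [p] stay in the half-space. In the comparison of exponents the linear
    parts cancel and the quadratic parts leave 2 Theta_ij, with factor - 1/2. *)
Lemma log_quadratic_second_difference n (k : 'I_n) (Theta : 'M[R]_n) K b
    (i j : 'I_n) (p : n.-tuple R) :
  let e l : n.-tuple R := [tuple (s == l)%:R | s < n] in
  0 < K -> i != j -> Theta^T = Theta -> 0 <= tnth p k ->
  log_quadratic k Theta K b (add_tuple (e i) p) *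
    log_quadratic k Theta K b (add_tuple (e j) p) <=
  log_quadratic k Theta K b (add_tuple (add_tuple (e i) (e j)) p) *
    log_quadratic k Theta K b p -> Theta i j <= 0.
Proof.
move=> e K0 ij Ts pk.
have ek l s : 0 <= tnth (e l) s by rewrite tnth_mktuple ler0n.
rewrite /log_quadratic pk !tnth_add_tuple !addr_ge0 //.
rewrite mulrACA [leRHS]mulrACA -!expRD ler_pM2l ?mulr_gt0 // ler_expR.
have vec_e l : vec (e l) = delta_mx l 0.
  by apply/colP => s; rewrite !mxE tnth_mktuple eqxx andbT.
have qE : quad_form Theta (vec (add_tuple (add_tuple (e i) (e j)) p)) +
    quad_form Theta (vec p) =
    quad_form Theta (vec (add_tuple (e i) p)) +
    quad_form Theta (vec (add_tuple (e j) p)) + 2 * Theta i j.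
  rewrite !vec_add !vec_e !quad_formD // bilin_formDr bilin_form_delta.
  have -> : Theta j i = Theta i j by rewrite -[in RHS]Ts mxE.
  ring.
have bE : (b *m vec (add_tuple (add_tuple (e i) (e j)) p)) 0 0 + (b *m vec p) 0 0 =
  (b *m vec (add_tuple (e i) p)) 0 0 + (b *m vec (add_tuple (e j) p)) 0 0.
  rewrite !vec_add !mulmxDr !mxE; ring.
lra.
Qed.
End log_quadratic.

(** * The density of the conditioned law and the passage from MTP2 to signs *)

Section log_quadratic_density.
Context {R : realType}.

Lemma mvnormal_log_quadratic n (k : 'I_n.+1) (Theta : 'M[R]_n.+1)
    (S : 'M[R]_n) (m : 'cV[R]_n) :
  S^T = S ->
  (forall x : 'cV[R]_n.+1, quad_form (invmx S) (diff_mx k *m x) = quad_form Theta x) ->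
  exists b : 'rV[R]_n.+1,
    (fun y => exponential_pdf 1 (tnth y k) *
       mvnormal_pdf m S (remove k (Defs.shift y (- tnth y k)))) =
    log_quadratic k Theta ((Num.sqrt ((2 * pi) ^+ n * \det S))^-1 *
      expR (- (quad_form (invmx S) m / 2))) b.
Proof.
(* The first term is the cross term of the normal exponent with its mean, the second is the exponent
   - y_k of the exponential density. *)
move=> Ss ST; exists (m^T *m invmx S *m diff_mx k - delta_mx 0 k).
apply/funext => y; rewrite /log_quadratic; case: ifPn => yk; last first.
  by rewrite lt0_exponential_pdf ?mul0r // ltNge.
rewrite exponential_pdfE // mul1r /mvnormal_pdf.
have -> : vec (remove k (Defs.shift y (- tnth y k))) = diff_mx k *m vec y.
  apply/colP => i; rewrite mxE (tnth_remove k _ i) tnth_shift.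
  by rewrite (mulmx_diff k (vec y) i 0) !mxE.
rewrite quad_formD ?trmx_inv ?Ss // ST.
set q := quad_form Theta _; set c := (Num.sqrt _)^-1.
rewrite mulrCA -!mulrA; congr (_ * _).
rewrite -!expRD; congr expR.
have -> : quad_form (invmx S) (- m) = quad_form (invmx S) m.
  by rewrite /quad_form [(- m)^T]linearN /= !mulNmx mulmxN opprK.
have -> : bilin_form (invmx S) (diff_mx k *m vec y) (- m) =
   - (m^T *m invmx S *m diff_mx k *m vec y) 0 0.
  rewrite bilin_formC ?trmx_inv ?Ss // /bilin_form [(- m)^T]linearN /=.
  by rewrite !mulNmx [LHS]mxE !mulmxA.
have -> : ((m^T *m invmx S *m diff_mx k - delta_mx 0 k) *m vec y) 0 0 =
    (m^T *m invmx S *m diff_mx k *m vec y) 0 0 - tnth y k.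
  by rewrite mulmxBl -rowE; set u := _ *m vec y; rewrite !mxE.
lra.
Qed.

Lemma has_density_eq n (mu nu : set (n.-tuple R) -> \bar R) f :
  (forall A, measurable A -> mu A = nu A) -> has_density nu f -> has_density mu f.
Proof. by move=> mn [mf f0 nuf]; split=> // A mA; rewrite mn // nuf. Qed.

Lemma husler_reiss_density d (T : measurableType d) (P : probability T R) n
    (Y : {RV P >-> n.+1.-tuple R}) (Gamma Theta : 'M[R]_n.+1) k :
  variogram_matrix Gamma -> hr_precision Gamma Theta -> husler_reiss Gamma Y ->
  exists (K : R) (b : 'rV[R]_n.+1), 0 < K /\
    has_density (cond_law Y k) (log_quadratic k Theta K b).
Proof.
move=> hG hT [_ /(_ k)[d' [T' [Q [W [E [QE WE Wk0 cE dW]]]]]]].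
set m := (X in mvnormal_pdf X) in dW.
have [b fE] := @mvnormal_log_quadratic n k Theta (hr_Sigma Gamma k) m
  (hr_Sigma_posdef hG k).1 (quad_form_hr_Theta (ltn0Sn n) hG hT k).
exists ((Num.sqrt ((2 * pi) ^+ n * \det (hr_Sigma Gamma k)))^-1 *
  expR (- (quad_form (invmx (hr_Sigma Gamma k)) m / 2))), b.
split; last first.
  rewrite -fE; apply: has_density_eq cE _.
  exact: shifted_density QE WE Wk0 dW.
(* The constant is nonzero because the normal density has integral 1. *)
rewrite mulr_gt0 ?expR_gt0 // lt_neqAle invr_ge0 sqrtr_ge0 andbT eq_sym.
apply/eqP => C0; have [_ _ /(_ _ measurableT)] := dW.
rewrite integral0_eq => [|x _]; last by rewrite /mvnormal_pdf C0 mul0r.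
by rewrite [X in Q X](_ : _ = setT) // probability_setT => /eqP; rewrite onee_eq0.
Qed.

Lemma add_tuple_ae n (v : n.-tuple R) (P : set (n.-tuple R)) :
  {ae lebesgue_tuple n, forall x, P x} ->
  {ae lebesgue_tuple n, forall x, P (add_tuple v x)}.
Proof.
move=> [N [mN N0 PN]]; exists (add_tuple v @^-1` N); split.
- by rewrite -[X in measurable X]setTI; exact: measurable_add_tuple.
- by rewrite -[RHS]N0; exact: lebesgue_tuple_translation.
- by move=> x nPx; exact: PN.
Qed.

(** The unit cube has measure one, so no null set contains it. *)
Lemma ae_exists_pos n (P : set (n.-tuple R)) :
  {ae lebesgue_tuple n, forall x, P x} -> exists2 x, P x & forall i, 0 <= tnth x i.
Proof.
move=> [N [mN N0 PN]]; apply: contrapT => nP.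
pose B := box (fun _ : 'I_n => `[0%R, 1%R]%classic : set R).
have mB : measurable B by exact: measurable_box.
have : (lebesgue_tuple n B <= lebesgue_tuple n N)%E.
  apply: le_measure; rewrite ?inE // => x bx; apply: PN => Px; apply: nP.
  by exists x => // i; have := bx i; rewrite /= in_itv /= => /andP[].
rewrite N0 [X in (X <= _)%E]lebesgue_tuple_box // big1 => [|i _].
  by rewrite lee_fin ler10.
by rewrite lebesgue_measure_itv /= lte_fin ltr01 oppr0 adde0.
Qed.

(** The two functions have equal integrals over every measurable set, and finite total mass makes
    [f] integrable. *)
Lemma has_density_ae_unique n (mu : set (n.-tuple R) -> \bar R) f g :
  (mu setT < +oo)%E -> has_density mu f -> has_density mu g ->
  {ae lebesgue_tuple n, forall x, f x = g x}.
Proof.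
move=> muoo [mf f0 muf] [mg g0 mug].
have fi : (lebesgue_tuple n).-integrable setT (EFin \o f).
  apply/integrableP; split; first exact/measurable_EFinP.
  under eq_integral do rewrite /= ger0_norm //.
  by rewrite -muf.
have := @integral_ae_eq _ _ _ (lebesgue_tuple n) setT measurableT (EFin \o g) (EFin \o f) fi.
case=> [|E _ mE|N [mN N0 sN]].
- exact/measurable_EFinP.
- by rewrite -muf // -mug.
- by exists N; split=> // x fg; apply: sN => /(_ I) [].
Qed.

Lemma MTP2_precision_le0 n (mu : set (n.-tuple R) -> \bar R) (k : 'I_n)
    (Theta : 'M[R]_n) K b :
  Theta^T = Theta -> 0 < K -> (mu setT < +oo)%E ->
  has_density mu (log_quadratic k Theta K b) -> MTP2 mu ->
  forall i j, i != j -> Theta i j <= 0.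
Proof.
move=> Ts K0 muoo df [g [dg gM]] i j ij.
pose e l : n.-tuple R := [tuple (s == l)%:R | s < n].
have fg := has_density_ae_unique muoo df dg.
pose f := log_quadratic k Theta K b.
pose fgv v x := f (add_tuple v x) = g (add_tuple v x).
(* The two versions must agree at all four corners p, p + e_i, p + e_j, p + e_i + e_j. Translation
   invariance makes each condition hold for almost every p. *)
have [p [[[fi fj] fij] fp] p0] : exists2 x,
    ((fgv (e i) x /\ fgv (e j) x) /\ fgv (add_tuple (e i) (e j)) x) /\ f x = g x &
    forall l, 0 <= tnth x l.
  apply: ae_exists_pos; apply: filterI => //.
  apply: filterI; last exact: (add_tuple_ae _ fg).
  by apply: filterI; exact: (add_tuple_ae _ fg).
apply: (@log_quadratic_second_difference _ _ k Theta K b i j p) => //.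
rewrite -/e -/f fi fj fij fp.
(* As i and j differ, the outer corners are the maximum and minimum of the two middle ones. *)
have -> : add_tuple (add_tuple (e i) (e j)) p = vmax (add_tuple (e i) p) (add_tuple (e j) p).
  apply: eq_from_tnth => l; rewrite tnth_vmax !tnth_add_tuple !tnth_mktuple -addr_maxr.
  congr (_ + _); have [->|_] := eqVneq l i; last by rewrite addr0 max_r ?ler0n.
  by rewrite (negPf ij) add0r max_l ?ler01.
have pE : vmin (add_tuple (e i) p) (add_tuple (e j) p) = p.
  apply: eq_from_tnth => l; rewrite tnth_vmin !tnth_add_tuple !tnth_mktuple -addr_minr.
  have [->|_] := eqVneq l i; last by rewrite min_l ?ler0n // addr0.
  by rewrite (negPf ij) min_r ?ler01 // addr0.
by rewrite -[X in _ <= _ * g X]pE; exact: gM.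
Qed.

Lemma EMTP2_precision d (T : measurableType d) (P : probability T R) n
    (Y : {RV P >-> n.+1.-tuple R}) (Gamma Theta : 'M[R]_n.+1) :
  variogram_matrix Gamma -> hr_precision Gamma Theta -> husler_reiss Gamma Y ->
  EMTP2 Y <-> (forall i j, i != j -> Theta i j <= 0).
Proof.
move=> hG hT hY; split=> [YM|T0 k]; last first.
  have [K [b [K0 df]]] := husler_reiss_density k hG hT hY.
  by exists (log_quadratic k Theta K b); split=> //; exact: log_quadratic_MTP2.
(* One conditioning index is enough here, since its density involves the whole of [Theta]. *)
have [K [b [K0 df]]] := husler_reiss_density ord0 hG hT hY.
apply: (MTP2_precision_le0 _ K0 _ df (YM ord0)); last by rewrite ltry.
exact: precision_tr hG hT.
Qed.
End log_quadratic_density.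

Theorem theorem3p4 (R : realType) (d : nat) (hd : (2 <= d)%N)
    (disp : measure_display) (T : measurableType disp) (P : probability T R)
    (Y : {RV P >-> d.-tuple R}) (Gamma Theta : 'M[R]_d)
    (hGamma : variogram_matrix Gamma)
    (hTheta : hr_precision Gamma Theta)
    (hY : husler_reiss Gamma Y) :
  (EMTP2 Y <-> connected_laplacian Theta) /\
  [/\ EMTP2 Y <-> (forall i j, i != j -> Theta i j <= 0),
      EMTP2 Y <-> (forall k, dd_M_matrix (hr_Theta Gamma k)),
      EMTP2 Y <-> (forall k, M_matrix (hr_Theta Gamma k)) &
      EMTP2 Y <-> (exists k, dd_M_matrix (hr_Theta Gamma k))].
Proof.
have d_gt0 : (0 < d)%N by exact: leq_trans hd.
have E : EMTP2 Y <-> (forall i j, i != j -> Theta i j <= 0).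
  case: d Y Gamma Theta hGamma hTheta hY d_gt0 {hd} => [//|n] Y Gamma Theta hG hT hY _.
  exact: EMTP2_precision hG hT hY.
split.
  split=> [/E|[_ _ T0 _]]; [exact: (precision_connected d_gt0 hGamma hTheta)|exact/E].
split=> //.
- split=> [/E|Hk]; first exact: (precision_le0_dd d_gt0 hGamma hTheta).
  by apply/E; apply: (M_matrix_precision_le0 d_gt0 hGamma hTheta) => k; have [] := Hk k.
- split=> [/E T0 k|Hk]; first by have [] := precision_le0_dd d_gt0 hGamma hTheta T0 k.
  by apply/E; exact: (M_matrix_precision_le0 d_gt0 hGamma hTheta).
- split=> [/E T0|[k Hk]].
    by exists (Ordinal d_gt0); exact: (precision_le0_dd d_gt0 hGamma hTheta).
  by apply/E; exact: (dd_M_matrix_precision_le0 d_gt0 hGamma hTheta Hk).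
Qed.
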